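(* Let $P_1,Q_1,R_1,S_1$ be four distinct collinear points in the real (resp. complex) projective plane. Let $R_2,S_2$ be two generic points in the plane. Define $r=(R_1R_2)$, $s=(S_1S_2)$, $t=(R_1S_2)$, $u=(R_2S_1)$, $A=r\cap s$, $B=t\cap u$. Pick a point $P_2\in(AP_1)$ such that the following constructions are well defined. Set $P_2'=(S_1P_2)\cap(BQ_1)$, $Q_2=(S_2P_2')\cap(AQ_1)$, $Q_2'=(R_1Q_2)\cap(BP_1)$. Then the points $Q_2',P_2,R_2$ are collinear.
   Context: $(XY)$ denotes the line through two distinct points $X,Y$. A construction is well defined if each line is drawn through two distinct points and each intersection point is taken of two distinct lines. ''Generic'' choices are choices belonging to a suitable Zariski dense subset of the appropriate configuration space (concretely: the conclusion holds for all choices in some nonempty Zariski open subset). *)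

(* Defs.v *)
(* Plane projective geometry over a field K, inside the lattice of linear
   subspaces of K^3 (MathComp): points are the 1-dimensional subspaces, lines
   the 2-dimensional ones, incidence is inclusion. *)
From HB Require Import structures.
From mathcomp Require Import all_boot all_order all_algebra.
From mathcomp Require Import mpoly.

Set Implicit Arguments.
Unset Strict Implicit.
Unset Printing Implicit Defensive.

Import GRing.Theory.
Local Open Scope ring_scope.

Record point (K : fieldType) := Point {
  point_space :> {vspace 'rV[K]_3};
  point_dim : \dim point_space == 1 }.

HB.instance Definition _ (K : fieldType) := [isSub for @point_space K].
HB.instance Definition _ (K : fieldType) := [Equality of point K by <:].

(* Joins and intersections are taken among all subspaces of K^3, so that they
   are total; [line_through X Y] is the line (XY) when X and Y are distinct
   points, and [meet l m] is a point when l and m are distinct lines. *)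
Definition line_through (K : fieldType) (X Y : {vspace 'rV[K]_3}) :
  {vspace 'rV[K]_3} := (X + Y)%VS.

Definition meet (K : fieldType) (l m : {vspace 'rV[K]_3}) :
  {vspace 'rV[K]_3} := (l :&: m)%VS.

(* The construction of (XY) \cap (ZW) is well defined. *)
Definition meet_well_defined (K : fieldType) (X Y Z W : {vspace 'rV[K]_3}) :=
  [/\ X != Y, Z != W & line_through X Y != line_through Z W].

Definition collinear (K : fieldType) (s : seq {vspace 'rV[K]_3}) : Prop :=
  exists2 l : {vspace 'rV[K]_3},
    \dim l = 2 & forall X, X \in s -> (X <= l)%VS.

(* Bihomogeneous polynomials in two groups of three variables. *)
Definition bihomogeneous (K : fieldType) (p : {mpoly K[3 + 3]}) : Prop :=
  exists d e : nat, forall m, m \in msupp p ->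
    (\sum_(i < 3) m (lshift 3 i))%N = d /\ (\sum_(i < 3) m (rshift 3 i))%N = e.

(* Value of p at homogeneous coordinates of (X, Y).  For bihomogeneous p its
   vanishing does not depend on the nonzero representatives picked. *)
Definition biform_eval (K : fieldType) (p : {mpoly K[3 + 3]})
    (X Y : point K) : K :=
  p.@[fun i => row_mx (vpick X) (vpick Y) 0 i].

(* Zariski open subsets of P^2(K) x P^2(K): complements of the common zero loci
   of sets of bihomogeneous polynomials. *)
Definition zariski_open (K : fieldType) (V : point K -> point K -> Prop) : Prop :=
  exists2 F : {mpoly K[3 + 3]} -> Prop,
    forall p, F p -> bihomogeneous p
  & forall X Y, V X Y <-> exists2 p, F p & biform_eval p X Y != 0.

Definition generically (K : fieldType) (C : point K -> point K -> Prop) : Prop :=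
  exists V : point K -> point K -> Prop,
    [/\ zariski_open V, exists X Y, V X Y & forall X Y, V X Y -> C X Y].

(* Main.v *)
Require Import Defs.
From mathcomp Require Import all_boot all_order all_algebra.
From mathcomp Require Import mpoly ring.
From mathcomp Require Import reals complex.

Set Implicit Arguments.
Unset Strict Implicit.
Unset Printing Implicit Defensive.

Import GRing.Theory.
Local Open Scope ring_scope.

(** The points R1, S1, R2, S2 are four vertices of a quadrangle with diagonal
    points A = (R1R2)(S1S2) and B = (R1S2)(R2S1), so the projective frame can be
    adapted to it: there are vectors r, s, a with R1 = <r>, S1 = <s>, A = <a>,
    R2 = <r + a>, S2 = <s + a>, whence B = <r + s + a>.  The points P1 and Q1 of
    the line (R1S1) are <p r + s> and <q r + s>, and a point P2 of (AP1) is
    <l (p r + s) + m a>.  Each further point of the construction is then found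
    explicitly, and Q2' turns out to be spanned by
      p (l (p r + s) + m a) + m (1 - p) (r + a),
    a combination of spanning vectors of P2 and R2.  This is
    [quadrangle_closure].

    The intersections never have to be solved for: two distinct lines meet in
    one point, so a nonzero vector lying on both spans their intersection
    ([meet_line]), and all that remains are identities between vectors.

    It remains to say for which R2, S2 such a frame exists.  Complete vectors r0
    and s0 of R1 and S1 to a basis r0, s0, e of K^3 and let x and y be vectors
    of R2 and S2 with coordinates x0, x1, x2 and y0, y1, y2.  What is needed is
    that R2 and S2 lie off the line (R1S1), i.e. x2 and y2 are nonzero, and that
    neither S1, R2, S2 nor R1, R2, S2 are collinear, i.e. x0 y2 - x2 y0 and
    x1 y2 - x2 y1 are nonzero; the frame is then given by [adapted_frame].
    The product of these four expressions is one bihomogeneous polynomial; it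
    does not vanish at R2 = <r0 + e>, S2 = <s0 + e>, so its nonvanishing locus
    is a nonempty open set.  The argument works over every field. *)

(** * Lines spanned by vectors and their intersections *)

Section Subspaces.
Variables (K : fieldType) (V : vectType K).
Implicit Types (x y z w v : V) (U W : {vspace V}).

Lemma free3P x y z :
  reflect (forall a b c : K, a *: x + b *: y + c *: z = 0 ->
             [/\ a = 0, b = 0 & c = 0])
          (free [:: x; y; z]).
Proof.
apply: (iffP idP) => [/(@freeP K V 3 [tuple x; y; z]) fr a b c abc0 | fr].
  have k0 := fr (fun i => [:: a; b; c]`_i).
  rewrite !big_ord_recl big_ord0 /= addr0 addrA in k0.
  have {}k0 := k0 abc0.
  by split; [apply: (k0 0) | apply: (k0 1) | apply: (k0 2)].
apply/(@freeP K V 3 [tuple x; y; z]) => k.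
rewrite !big_ord_recl big_ord0 /= addr0 addrA => /fr[k0 k1 k2].
by case=> [[|[|[|//]]] lt_i];
  [rewrite -[RHS]k0 | rewrite -[RHS]k1 | rewrite -[RHS]k2];
  congr (k _); apply: val_inj.
Qed.

Lemma free3_nz x y z : free [:: x; y; z] -> [/\ x != 0, y != 0 & z != 0].
Proof.
move/free3P=> fr; split; apply: contraTneq isT => v0.
- case: (fr 1 0 0); first by rewrite v0 !scale0r scaler0 !addr0.
  by move/eqP; rewrite oner_eq0.
- case: (fr 0 1 0); first by rewrite v0 !scale0r scaler0 !addr0.
  by move=> _ /eqP; rewrite oner_eq0.
- case: (fr 0 0 1); first by rewrite v0 !scale0r scaler0 !addr0.
  by move=> _ _ /eqP; rewrite oner_eq0.
Qed.

Lemma mem_join v x y :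
  reflect (exists a b : K, v = a *: x + b *: y) (v \in <[x]> + <[y]>)%VS.
Proof.
apply: (iffP memv_addP) => [[u /vlineP[a ->] [u' /vlineP[b ->] ->]]|[a [b ->]]].
  by exists a, b.
by exists (a *: x); rewrite ?memvZ ?memv_line //; exists (b *: y);
   rewrite ?memvZ ?memv_line.
Qed.

Lemma vlineZ (a : K) x : a != 0 -> <[a *: x]>%VS = <[x]>%VS.
Proof.
move=> a0; apply: subv_anti; rewrite -!memvE memvZ ?memv_line //=.
by apply/vlineP; exists a^-1; rewrite scalerA mulVf // scale1r.
Qed.

(** If the dimension did not drop, the intersection would be all of U and all
    of W.  For points and lines this is the uniqueness in the incidence axioms:
    n = 0 makes the join of two points a line, n = 1 makes the meet of two lines
    at most a point. *)
Lemma dim_cap_neq U W n :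
  \dim U = n.+1 -> \dim W = n.+1 -> U != W -> (\dim (U :&: W) <= n)%N.
Proof.
move=> dU dW; rewrite -ltnS -dU; apply: contraNT; rewrite -leqNgt => leUW.
have /eqP capU : (U :&: W == U)%VS by rewrite eqEdim capvSl.
by rewrite eqEdim dU dW leqnn andbT -capU capvSr.
Qed.

Lemma dim_join U W :
  \dim U = 1%N -> \dim W = 1%N -> U != W -> \dim (U + W) = 2%N.
Proof.
move=> dU dW /(dim_cap_neq dU dW); rewrite leqn0 => /eqP cap0.
by have := dimv_sum_cap U W; rewrite cap0 dU dW addn0.
Qed.

End Subspaces.

Section Plane.
Variable K : fieldType.
Implicit Types (r s a e x y z w v : 'rV[K]_3).

(** An intersection of two lines is computed by exhibiting one nonzero vector
    on both, never by solving equations. *)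
Lemma meet_line (X Y Z W : {vspace 'rV[K]_3}) v :
    \dim X = 1%N -> \dim Y = 1%N -> \dim Z = 1%N -> \dim W = 1%N ->
    meet_well_defined X Y Z W -> v != 0 ->
    v \in line_through X Y -> v \in line_through Z W ->
  meet (line_through X Y) (line_through Z W) = <[v]>%VS.
Proof.
move=> dX dY dZ dW [XY ZW lm] v0 vl vm; apply/esym/eqP.
rewrite eqEdim -memvE memv_cap vl vm dim_vline v0 /=.
exact: (dim_cap_neq (dim_join dX dY XY) (dim_join dZ dW ZW) lm).
Qed.

Lemma free_vline_neq x y z : free [:: x; y; z] -> (<[x]> != <[y]>)%VS.
Proof.
move/free3P=> fr; apply/eqP=> xy.
have /vlineP[k xk] : x \in <[y]>%VS by rewrite -xy memv_line.
case: (fr 1 (- k) 0); first by rewrite xk scale1r scaleNr subrr scale0r addr0.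
by move/eqP; rewrite oner_eq0.
Qed.

(** The lines differ because z is on the second but off the first. *)
Lemma free_meet_well_defined x y z w :
    free [:: x; y; z] -> free [:: z; w; x] ->
  meet_well_defined <[x]>%VS <[y]>%VS <[z]>%VS <[w]>%VS.
Proof.
move=> fr1 fr2; split; [exact: free_vline_neq fr1|exact: free_vline_neq fr2|].
apply/eqP=> lm.
have : z \in line_through <[x]> <[y]>.
  by rewrite lm (subvP (addvSl _ _)) ?memv_line.
case/mem_join=> a [b zE]; move/free3P: fr1 => /(_ a b (-1)).
rewrite zE scaleN1r subrr => /(_ erefl)[_ _ /eqP].
by rewrite oppr_eq0 oner_eq0.
Qed.

Lemma vpick_point_neq0 (X : point K) : vpick X != 0.
Proof. by rewrite vpick0 -dimv_eq0 (eqP (point_dim X)). Qed.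

Lemma point_vline (X : point K) : X = <[vpick X]>%VS :> {vspace _}.
Proof.
apply/esym/eqP; rewrite eqEdim -memvE memv_pick dim_vline vpick_point_neq0.
by rewrite (eqP (point_dim X)).
Qed.

Ltac vec_ring := apply/rowP=> ?; rewrite !mxE; ring.

(** * The construction in an adapted frame *)

(** The coordinates of each constructed point come from cancelling the extra
    unknown on the two lines, e.g. P2' = <q P2 + k s> = <m q B + (l p - m) Q1>
    on representatives.  The parameters l and m are not both zero, and p, q are
    nonzero because P1 and Q1 differ from S1; this keeps all the spanning
    vectors nonzero. *)
Lemma quadrangle_closure r s a (p q : K) (R1 S1 R2 S2 P1 Q1 : point K) :
    free [:: r; s; a] -> p != 0 -> q != 0 ->
    R1 = <[r]>%VS :> {vspace _} -> S1 = <[s]>%VS :> {vspace _} ->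
    R2 = <[r + a]>%VS :> {vspace _} -> S2 = <[s + a]>%VS :> {vspace _} ->
    P1 = <[p *: r + s]>%VS :> {vspace _} ->
    Q1 = <[q *: r + s]>%VS :> {vspace _} ->
  let A := meet (line_through R1 R2) (line_through S1 S2) in
  let B := meet (line_through R1 S2) (line_through R2 S1) in
  [/\ meet_well_defined R1 R2 S1 S2, meet_well_defined R1 S2 R2 S1,
      A != P1 &
      forall P2 : point K, (P2 <= line_through A P1)%VS ->
      let P2' := meet (line_through S1 P2) (line_through B Q1) in
      let Q2 := meet (line_through S2 P2') (line_through A Q1) in
      let Q2' := meet (line_through R1 Q2) (line_through B P1) in
      meet_well_defined S1 P2 B Q1 ->
      meet_well_defined S2 P2' A Q1 ->
      meet_well_defined R1 Q2 B P1 ->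
      collinear [:: Q2'; P2 : {vspace _}; R2 : {vspace _}]].
Proof.
move=> fr p0 q0 eR1 eS1 eR2 eS2 eP1 eQ1 A B; have ind := free3P _ _ _ fr.
have nz (i j k : K) : [|| i != 0, j != 0 | k != 0] ->
    i *: r + j *: s + k *: a != 0.
  by apply: contraTneq => /ind[-> -> ->]; rewrite !eqxx.
have wdA : meet_well_defined R1 R2 S1 S2.
  rewrite eR1 eR2 eS1 eS2; apply: free_meet_well_defined; apply/free3P=> i j k.
    have ->: i *: r + j *: (r + a) + k *: s = (i + j) *: r + k *: s + j *: a
      by vec_ring.
    by case/ind=> h -> j0; move: h; rewrite j0 addr0.
  have ->: i *: s + j *: (s + a) + k *: r = k *: r + (i + j) *: s + j *: a
    by vec_ring.
  by case/ind=> -> h j0; move: h; rewrite j0 addr0.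
have wdB : meet_well_defined R1 S2 R2 S1.
  rewrite eR1 eR2 eS1 eS2; apply: free_meet_well_defined; apply/free3P=> i j k.
    have ->: i *: r + j *: (s + a) + k *: (r + a)
        = (i + k) *: r + j *: s + (j + k) *: a by vec_ring.
    by case/ind=> ik -> jk; move: jk ik; rewrite add0r => ->; rewrite addr0.
  have ->: i *: (r + a) + j *: s + k *: r = (i + k) *: r + j *: s + i *: a
    by vec_ring.
  by case/ind=> h -> i0; move: h; rewrite i0 add0r.
have dim1 (X : point K) : \dim X = 1%N by apply/eqP/point_dim.
have eA : A = <[a]>%VS.
  apply: meet_line => //; first by case/free3_nz: fr.
    by rewrite eR1 eR2; apply/mem_join; exists (-1), 1; vec_ring.
  by rewrite eS1 eS2; apply/mem_join; exists (-1), 1; vec_ring.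
have nzB : r + s + a != 0.
  have ->: r + s + a = 1 *: r + 1 *: s + 1 *: a by vec_ring.
  by rewrite nz // oner_eq0.
have eB : B = <[r + s + a]>%VS.
  apply: meet_line => //.
  - by rewrite eR1 eS2; apply/mem_join; exists 1, 1; vec_ring.
  - by rewrite eR2 eS1; apply/mem_join; exists 1, 1; vec_ring.
have dA : \dim A = 1%N by rewrite eA dim_vline; case/free3_nz: fr => _ _ ->.
have dB : \dim B = 1%N by rewrite eB dim_vline nzB.
split=> //.
  rewrite eA eP1; apply: (@free_vline_neq _ _ r); apply/free3P=> i j k.
  have ->: i *: a + j *: (p *: r + s) + k *: r
    = (j * p + k) *: r + j *: s + i *: a by vec_ring.
  by case/ind=> h j0 ->; move: h; rewrite j0 mul0r add0r.
move=> P2 P2on P2' Q2 Q2' wdP2' wdQ2 wdQ2'.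
have P2n0 := vpick_point_neq0 P2; have eP2 := point_vline P2.
have := subvP P2on _ (memv_pick P2); rewrite eA eP1 => /mem_join[m [l vE]].
have {vE} [vE lm0] : vpick P2 = (l * p) *: r + l *: s + m *: a
    /\ (l != 0) || (m != 0).
  have ->: (l * p) *: r + l *: s + m *: a = m *: a + l *: (p *: r + s)
    by vec_ring.
  split=> //; move: P2n0; rewrite vE; apply: contraNT.
  by rewrite negb_or !negbK => /andP[/eqP-> /eqP->]; rewrite !scale0r addr0.
rewrite vE in eP2.
have nzP2' : (l * p * q) *: r + (m * q + l * p - m) *: s + (m * q) *: a != 0.
  by apply: nz; rewrite !mulf_eq0 (negPf p0) (negPf q0) !orbF orbCA lm0 orbT.
have eP2' : P2' = <[(l * p * q) *: r + (m * q + l * p - m) *: s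
                    + (m * q) *: a]>%VS.
  apply: meet_line => //.
  - rewrite eS1 eP2; apply/mem_join.
    by exists (m * q + l * p - m - q * l), q; vec_ring.
  - by rewrite eB eQ1; apply/mem_join; exists (m * q), (l * p - m); vec_ring.
have dP2' : \dim P2' = 1%N by rewrite eP2' dim_vline nzP2'.
have nzQ2 : (l * p * q) *: r + (l * p) *: s + m *: a != 0.
  by apply: nz; rewrite !mulf_eq0 (negPf p0) (negPf q0) !orbF orbA orbb.
have eQ2 : Q2 = <[(l * p * q) *: r + (l * p) *: s + m *: a]>%VS.
  apply: meet_line => //.
  - by rewrite eS2 eP2'; apply/mem_join; exists (m - m * q), 1; vec_ring.
  - by rewrite eA eQ1; apply/mem_join; exists m, (l * p); vec_ring.
have dQ2 : \dim Q2 = 1%N by rewrite eQ2 dim_vline nzQ2.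
have eQ2' : Q2' = <[(m + l * p * p - m * p) *: r + (l * p) *: s + m *: a]>%VS.
  apply: meet_line => //.
  - by apply: nz; rewrite !mulf_eq0 (negPf p0) !orbF lm0 orbT.
  - rewrite eR1 eQ2; apply/mem_join.
    by exists (m + l * p * p - m * p - l * p * q), 1; vec_ring.
  - by rewrite eB eP1; apply/mem_join; exists m, (l * p - m); vec_ring.
exists (P2 + R2)%VS.
  (* P2 is not R2: a nonzero vector of P2 with no s-part has l = 0, hence no
     r-part, unlike r + a. *)
  apply: dim_join => //; rewrite eP2 eR2; apply/eqP => PR.
  have /vlineP[k raE] : r + a \in <[(l * p) *: r + l *: s + m *: a]>%VS.
    by rewrite PR memv_line.
  have: (1 - k * (l * p)) *: r + (- (k * l)) *: s + (1 - k * m) *: a = 0.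
    by move/eqP: raE; rewrite -subr_eq0 => /eqP <-; vec_ring.
  case/ind=> + /eqP; rewrite oppr_eq0 mulf_eq0 => /eqP + /orP[] /eqP k0.
    by rewrite k0 mul0r subr0 oner_eq0.
  by rewrite k0 mul0r mulr0 subr0 oner_eq0.
move=> X; rewrite !inE => /or3P[] /eqP->; rewrite ?addvSl ?addvSr //.
rewrite eQ2' eP2 eR2 -memvE; apply/mem_join.
by exists p, (m * (1 - p)); vec_ring.
Qed.

(** A spanning vector can be scaled to have s-coefficient 1 because X is not
    <r>; then p is nonzero because X is not <s>. *)
Lemma point_on_join r s (X : point K) :
    (X <= <[r]> + <[s]>)%VS -> X != <[r]>%VS :> {vspace _} ->
    X != <[s]>%VS :> {vspace _} ->
  exists2 p : K, p != 0 & X = <[p *: r + s]>%VS :> {vspace _}.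
Proof.
move=> Xrs; rewrite {1 2}(point_vline X).
have := subvP Xrs _ (memv_pick X) => /mem_join[c [d xE]].
have := vpick_point_neq0 X; rewrite xE; have [-> | c0] := eqVneq c 0.
  rewrite scale0r add0r; have [-> | d0] := eqVneq d 0.
    by rewrite scale0r eqxx.
  by rewrite vlineZ ?eqxx.
have [-> | d0 _ _ _] := eqVneq d 0; first by rewrite scale0r addr0 vlineZ ?eqxx.
exists (d^-1 * c); first by rewrite mulf_neq0 ?invr_eq0.
rewrite (point_vline X) xE -(vlineZ _ (_ : d^-1 != 0)) ?invr_eq0 //.
by rewrite scalerDr !scalerA mulVf // scale1r.
Qed.

(** Dual basis of r, s, e: the coordinates are kept as linear forms on K^3 so
    that they can be turned into polynomials in the standard coordinates. *)
Lemma free3_coords r s e : free [:: r; s; e] ->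
  exists f0 f1 f2 : {scalar 'rV[K]_3},
    (forall x, x = f0 x *: r + f1 x *: s + f2 x *: e) /\
    (forall (i j k : K) (x := i *: r + j *: s + k *: e),
       [/\ f0 x = i, f1 x = j & f2 x = k]).
Proof.
move=> fr; pose b := [tuple r; s; e].
have bV : basis_of fullv b by rewrite basisEfree fr subvf dimvf /dim /= mul1n.
have decomp x : x = coord b 0 x *: r + coord b 1 x *: s + coord b 2 x *: e.
  have := coord_span (_ : x \in <<b>>%VS); rewrite (span_basis bV) memvf.
  move=> /(_ isT) {1}->; rewrite !big_ord_recl big_ord0 addr0 addrA.
  by congr (coord b _ x *: _ + coord b _ x *: _ + coord b _ x *: _);
     apply: val_inj.
exists (coord b 0), (coord b 1), (coord b 2); split=> // i j k x.
have [] := free3P _ _ _ fr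
  (coord b 0 x - i) (coord b 1 x - j) (coord b 2 x - k).
  transitivity (x - x); last exact: subrr.
  by rewrite {4}[x]decomp /x; vec_ring.
by move=> /subr0_eq ? /subr0_eq ? /subr0_eq ?.
Qed.

(** The relation y2 x - x2 y = al r + be s, obtained by eliminating e, shows
    that a := y2 x - al r = x2 y + be s lies on both lines <r> + <x> and
    <s> + <y>.  Rescaling r to al r and s to - be s then gives x ~ r' + a and y ~ s' + a. *)
Lemma adapted_frame r s e x y (x0 x1 x2 y0 y1 y2 : K) :
    free [:: r; s; e] ->
    x = x0 *: r + x1 *: s + x2 *: e -> y = y0 *: r + y1 *: s + y2 *: e ->
    x2 != 0 -> y2 != 0 -> x0 * y2 - x2 * y0 != 0 -> x1 * y2 - x2 * y1 != 0 ->
  exists r' s' a, [/\ free [:: r'; s'; a],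
    <[r']>%VS = <[r]>%VS, <[s']>%VS = <[s]>%VS,
    <[r' + a]>%VS = <[x]>%VS & <[s' + a]>%VS = <[y]>%VS].
Proof.
move=> fr xE yE nx ny; set al := _ - _; set be := _ - _ => nal nbe.
exists (al *: r), (- be *: s).
exists ((x2 * y0) *: r + (x1 * y2) *: s + (x2 * y2) *: e).
split; rewrite ?vlineZ ?oppr_eq0 //.
- apply/free3P=> i j k eq0.
  have [] := free3P _ _ _ fr (i * al + k * (x2 * y0)) (k * (x1 * y2) - j * be)
    (k * (x2 * y2)); first by rewrite -eq0; vec_ring.
  move=> + + /eqP; rewrite !mulf_eq0 (negPf nx) (negPf ny) !orbF => + + /eqP k0.
  rewrite k0 !mul0r addr0 add0r => /eqP + /eqP.
  rewrite oppr_eq0 !mulf_eq0 (negPf nal) (negPf nbe) !orbF.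
  by move=> /eqP-> /eqP->.
- by rewrite -(vlineZ x ny) xE; congr (<[_]>%VS); rewrite /al; vec_ring.
- by rewrite -(vlineZ y nx) yE; congr (<[_]>%VS); rewrite /be; vec_ring.
Qed.

(** * Bihomogeneous polynomials from linear forms *)

(** Homogeneity in each group of variables with the two degrees fixed; unlike
    their mere existence, this is stable under sums. *)
Definition bidegree (d1 d2 : nat) (p : {mpoly K[3 + 3]}) :=
  forall m, m \in msupp p ->
    (\sum_(i < 3) m (lshift 3 i))%N = d1 /\ (\sum_(i < 3) m (rshift 3 i))%N = d2.

Lemma bidegreeM d1 d2 d1' d2' p q :
  bidegree d1 d2 p -> bidegree d1' d2' q ->
  bidegree (d1 + d1') (d2 + d2') (p * q).
Proof.
move=> bp bq _ /msuppM_le/allpairsP[[m n] /= [/bp[<- <-] /bq[<- <-] ->]].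
by split; rewrite -big_split; apply: eq_bigr => i _; rewrite mnmDE.
Qed.

Lemma bidegreeB d1 d2 p q :
  bidegree d1 d2 p -> bidegree d1 d2 q -> bidegree d1 d2 (p - q).
Proof. by move=> bp bq m /msuppB_le; rewrite mem_cat => /orP[/bp|/bq]. Qed.

Lemma bidegree_sum d1 d2 n (F : 'I_n -> {mpoly K[3 + 3]}) :
  (forall i, bidegree d1 d2 (F i)) -> bidegree d1 d2 (\sum_i F i).
Proof.
move=> bF; apply: (big_ind (bidegree d1 d2)) => // [m|p q bp bq m].
  by rewrite msupp0.
by move/msuppD_le; rewrite mem_cat => /orP[/bp|/bq].
Qed.

Definition form_fst (f : {scalar 'rV[K]_3}) : {mpoly K[3 + 3]} :=
  \sum_(i < 3) f 'e_i *: 'X_(lshift 3 i).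

Definition form_snd (f : {scalar 'rV[K]_3}) : {mpoly K[3 + 3]} :=
  \sum_(i < 3) f 'e_i *: 'X_(rshift 3 i).

Lemma bidegree_form_fst f : bidegree 1 0 (form_fst f).
Proof.
apply: bidegree_sum => i m /msuppZ_le; rewrite msuppX inE => /eqP->; split.
  rewrite (bigD1 i) //= mnm1E eqxx big1 // => j /negPf ji.
  by rewrite mnm1E (inj_eq (@lshift_inj _ _)) eq_sym ji.
by rewrite big1 // => j _; rewrite mnm1E eq_lrshift.
Qed.

Lemma bidegree_form_snd f : bidegree 0 1 (form_snd f).
Proof.
apply: bidegree_sum => i m /msuppZ_le; rewrite msuppX inE => /eqP->; split.
  by rewrite big1 // => j _; rewrite mnm1E eq_rlshift.
rewrite (bigD1 i) //= mnm1E eqxx big1 // => j /negPf ji.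
by rewrite mnm1E (inj_eq (@rshift_inj _ _)) eq_sym ji.
Qed.

Lemma scalar_sum (f : {scalar 'rV[K]_3}) x : f x = \sum_(i < 3) f 'e_i * x 0 i.
Proof.
rewrite [in LHS](row_sum_delta x) linear_sum; apply: eq_bigr => i _.
by rewrite linearZ mulrC.
Qed.

Lemma form_fstE f x y : (form_fst f).@[fun i => row_mx x y 0 i] = f x.
Proof.
rewrite raddf_sum [RHS]scalar_sum; apply: eq_bigr => i _.
by rewrite /= mevalZ mevalXU row_mxEl.
Qed.

Lemma form_sndE f x y : (form_snd f).@[fun i => row_mx x y 0 i] = f y.
Proof.
rewrite raddf_sum [RHS]scalar_sum; apply: eq_bigr => i _.
by rewrite /= mevalZ mevalXU row_mxEr.
Qed.

(** * Generic choice of R2 and S2 *)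

Lemma vpick_vline v : v != 0 -> exists2 k : K, k != 0 & vpick <[v]> = k *: v.
Proof.
move=> v0; have /vlineP[k kE] := memv_pick <[v]>%VS; exists k => //.
apply: contraTneq v0 => k0; move/eqP: kE; rewrite k0 scale0r vpick0.
by rewrite -dimv_eq0 dim_vline; case: (v == 0).
Qed.

Lemma dim_vline_point v : v != 0 -> \dim <[v]>%VS == 1%N.
Proof. by rewrite dim_vline => ->. Qed.

(** [quadrangle_closure] holds on the nonvanishing locus of the product of the
    four forms that express that R1, S1, R2, S2 are in general position. *)
Theorem generic_quadrangle_closure (P1 Q1 R1 S1 : point K) :
    uniq [:: P1; Q1; R1; S1] ->
    collinear [seq point_space X | X <- [:: P1; Q1; R1; S1]] ->
    generically (fun R2 S2 : point K =>
      let r := line_through R1 R2 in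
      let s := line_through S1 S2 in
      let t := line_through R1 S2 in
      let u := line_through R2 S1 in
      let A := meet r s in
      let B := meet t u in
      [/\ meet_well_defined R1 R2 S1 S2, meet_well_defined R1 S2 R2 S1,
          A != P1 &
      forall P2 : point K, (P2 <= line_through A P1)%VS ->
      let P2' := meet (line_through S1 P2) (line_through B Q1) in
      let Q2 := meet (line_through S2 P2') (line_through A Q1) in
      let Q2' := meet (line_through R1 Q2) (line_through B P1) in
      meet_well_defined S1 P2 B Q1 ->
      meet_well_defined S2 P2' A Q1 ->
      meet_well_defined R1 Q2 B P1 ->
      collinear [:: Q2'; P2 : {vspace _}; R2 : {vspace _}]]).
Proof.
have pt_eqE (X Y : point K) : (X == Y) = (X == Y :> {vspace 'rV[K]_3}) by [].
rewrite /= !inE !negb_or !pt_eqE =>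
  /and4P[/and3P[_ P1R1 P1S1] /andP[Q1R1 Q1S1] R1S1 _].
case=> l dl onl.
have [P1l Q1l R1l S1l] :
    [/\ (P1 <= l)%VS, (Q1 <= l)%VS, (R1 <= l)%VS & (S1 <= l)%VS].
  by split; apply: onl; rewrite !inE eqxx ?orbT.
have dim1 (X : point K) : \dim X = 1%N by apply/eqP/point_dim.
have lE : l = (<[vpick R1]> + <[vpick S1]>)%VS.
  apply/esym/eqP; rewrite -!point_vline eqEdim subv_add R1l S1l dl.
  by rewrite (dim_join (dim1 _) (dim1 _)).
set r := vpick R1 in lE *; set s := vpick S1 in lE *.
pose e := vpick (l^C)%VS.
have e_notin : e \notin l.
  have e0 : e != 0 by rewrite vpick0 -dimv_eq0 dimv_compl dl dimvf.
  apply: contra e0 => el; rewrite -memv0 -(capv_compl l).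
  by rewrite memv_cap el memv_pick.
have fr : free [:: r; s; e].
  rewrite (perm_free (_ : perm_eq _ [:: e; r; s])).
    rewrite !free_cons !span_cons span_nil addv0 -lE e_notin nil_free.
    rewrite memv0 vpick_point_neq0 !andbT /= memvE -!point_vline.
    by apply: contra R1S1 => R1S1; rewrite eqEdim R1S1 !dim1.
  by rewrite -[[:: r; s; e]]/(rcons [:: r; s] e) perm_rcons.
have [f0 [f1 [f2 [decomp coords]]]] := free3_coords fr.
pose p := form_fst f2 * form_snd f2
  * (form_fst f0 * form_snd f2 - form_fst f2 * form_snd f0)
  * (form_fst f1 * form_snd f2 - form_fst f2 * form_snd f1).
have pE (X Y : point K) (x := vpick X) (y := vpick Y) : biform_eval p X Y =
    f2 x * f2 y * (f0 x * f2 y - f2 x * f0 y) * (f1 x * f2 y - f2 x * f1 y).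
  by rewrite /biform_eval !(mevalM, mevalB) !form_fstE !form_sndE.
exists (fun X Y => biform_eval p X Y != 0); split.
- exists (eq p) => [_ <- | X Y].
    have b1 := bidegree_form_fst; have b2 := bidegree_form_snd.
    have b12 f g := bidegreeM (b1 f) (b2 g).
    have b3 f g := bidegreeB (b12 f g) (b12 g f).
    have b := bidegreeM (bidegreeM (b12 f2 f2) (b3 f0 f2)) (b3 f1 f2).
    by do 2!eexists; exact: b.
  by split=> [|[_ <-]]; [exists p | ].
- have re0 : r + e != 0.
    apply: contraNneq e_notin => /eqP; rewrite addrC addr_eq0 => /eqP->.
    by rewrite memvN memvE -point_vline.
  have se0 : s + e != 0.
    apply: contraNneq e_notin => /eqP; rewrite addrC addr_eq0 => /eqP->.
    by rewrite memvN memvE -point_vline.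
  exists (Point (dim_vline_point re0)), (Point (dim_vline_point se0)).
  rewrite pE /=; have [k k0 ->] := vpick_vline re0.
  have [k' k'0 ->] := vpick_vline se0.
  have ->: k *: (r + e) = k *: r + 0 *: s + k *: e by vec_ring.
  have ->: k' *: (s + e) = 0 *: r + k' *: s + k' *: e by vec_ring.
  have [-> -> ->] := coords k 0 k; have [-> -> ->] := coords 0 k' k'.
  by rewrite !(mulr0, mul0r, subr0, sub0r) !mulf_neq0 // oppr_eq0 mulf_neq0.
move=> R2 S2; rewrite pE !mulf_eq0 !negb_or -!andbA => /and4P[x2 y2 x0 x1].
have [r' [s' [a [fr' rE sE r2E s2E]]]] :=
  adapted_frame fr (decomp (vpick R2)) (decomp (vpick S2)) x2 y2 x0 x1.
have [c c0 P1E] : exists2 c, c != 0 & P1 = <[c *: r' + s']>%VS :> {vspace _}.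
  by apply: point_on_join; rewrite ?rE ?sE -?lE // -point_vline.
have [d d0 Q1E] : exists2 d, d != 0 & Q1 = <[d *: r' + s']>%VS :> {vspace _}.
  by apply: point_on_join; rewrite ?rE ?sE -?lE // -point_vline.
by apply: (quadrangle_closure fr' c0 d0);
   rewrite ?rE ?sE ?r2E ?s2E // -point_vline.
Qed.

End Plane.

Theorem theorem7p11 (R : realType) :
  let claim (K : fieldType) :=
    forall P1 Q1 R1 S1 : point K,
    uniq [:: P1; Q1; R1; S1] ->
    collinear [seq point_space X | X <- [:: P1; Q1; R1; S1]] ->
    generically (fun R2 S2 : point K =>
      let r := line_through R1 R2 in
      let s := line_through S1 S2 in
      let t := line_through R1 S2 in
      let u := line_through R2 S1 in
      let A := meet r s in
      let B := meet t u in
      [/\ meet_well_defined R1 R2 S1 S2, meet_well_defined R1 S2 R2 S1,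
          A != P1 &
      forall P2 : point K, (P2 <= line_through A P1)%VS ->
      let P2' := meet (line_through S1 P2) (line_through B Q1) in
      let Q2 := meet (line_through S2 P2') (line_through A Q1) in
      let Q2' := meet (line_through R1 Q2) (line_through B P1) in
      meet_well_defined S1 P2 B Q1 ->
      meet_well_defined S2 P2' A Q1 ->
      meet_well_defined R1 Q2 B P1 ->
      collinear [:: Q2'; P2 : {vspace _}; R2 : {vspace _}]]) in
  claim R /\ claim (R[i])%C.
Proof. by split=> P1 Q1 R1 S1; exact: generic_quadrangle_closure. Qed.
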